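(* Let $\mathcal X=\{x\in\mathbb R^d: Ax\le b\}$ be a nonempty bounded polytope and let $\mathcal C\subseteq\mathbb R^d$ be a nonempty convex set. A (nonempty) affine subspace $V\subseteq\mathbb R^d$ is exact-sketching on $\mathcal C$, i.e. satisfies $$\operatorname*{arg\,min}_{x\in\mathcal X\cap V} c^\top x=\operatorname*{arg\,min}_{x\in\mathcal X} c^\top x\qquad\text{for every } c\in\mathcal C,$$ if and only if $$\operatorname{dir}(\mathcal X^\star(\mathcal C))\subseteq \operatorname{dir}(V)\quad\text{and}\quad V\cap\mathcal X^\star(\mathcal C)\neq\emptyset .$$
   Context: For $c\in\mathbb R^d$, $\mathcal X^\star(c):=\operatorname*{arg\,min}_{x\in\mathcal X}c^\top x$ (the set of all minimizers), and $\mathcal X^\star(\mathcal C):=\bigcup_{c\in\mathcal C}\mathcal X^\star(c)$. For a set $S\subseteq\mathbb R^d$, $\operatorname{dir}(S):=\operatorname{span}\{x-x':x,x'\in S\}$; in particular, for an affine subspace $V$, $\operatorname{dir}(V)$ is its direction (linear) subspace. *)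

(* Defs.v *)
From HB Require Import structures.
From mathcomp Require Export all_boot all_order all_algebra.
From mathcomp Require Export all_classical all_reals all_analysis.

Export Order.TTheory GRing.Theory Num.Theory.
Export numFieldNormedType.Exports.

Set Implicit Arguments.
Unset Strict Implicit.
Unset Printing Implicit Defensive.

Local Open Scope classical_set_scope.
Local Open Scope ring_scope.

Definition polyhedron {R : realType} {m d : nat} (A : 'M[R]_(m, d))
    (b : 'cV[R]_m) : set 'cV[R]_d :=
  [set x | forall i, (A *m x) i 0 <= b i 0].

Definition argmin {R : realType} {T : Type} (D : set T) (f : T -> R) : set T :=
  [set x | D x /\ forall y, D y -> f x <= f y].

Definition linobj {R : realType} {d : nat} (c x : 'cV[R]_d) : R :=
  (c^T *m x) 0 0.

Definition optimal_set {R : realType} {d : nat} (X : set 'cV[R]_d)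
    (c : 'cV[R]_d) : set 'cV[R]_d :=
  argmin X (linobj c).

Definition reachable_optima {R : realType} {d : nat} (X C : set 'cV[R]_d) :
    set 'cV[R]_d :=
  \bigcup_(c in C) optimal_set X c.

(* [span] is only available for finite sequences; the span of an arbitrary set
   is the union of the spans of its finite families. *)
Definition set_span {R : realType} {d : nat} (S : set 'cV[R]_d) :
    set 'cV[R]_d :=
  [set v | exists2 s : seq 'cV[R]_d, {in s, forall x, S x} & v \in span s].

Definition dir {R : realType} {d : nat} (S : set 'cV[R]_d) : set 'cV[R]_d :=
  set_span [set x - y | x in S & y in S].

(* Nonempty by construction: it contains its base point [p]. *)
Definition affine_subspace {R : realType} {d : nat} (V : set 'cV[R]_d) : Prop :=
  exists (p : 'cV[R]_d) (L : {vspace 'cV[R]_d}), V = [set p + u | u in [set` L]].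

Definition exact_sketching {R : realType} {d : nat} (X C V : set 'cV[R]_d) :
    Prop :=
  forall c, C c -> argmin (X `&` V) (linobj c) = argmin X (linobj c).

(* Main.v *)
Require Import Defs.

(** Restricting a minimization over [X] to [X `&` V] leaves the set of minimizers
    unchanged exactly when every minimizer already lies in [V], provided the
    original problem has a minimizer at all ([argmin_setI_eq]): one minimizer
    inside [V] is enough for both problems to have the same optimal value. A
    polytope is compact, so each linear objective attains its minimum on it, and
    exact sketching on [C] becomes the single inclusion of
    [reachable_optima X C] into [V].

    For an affine [V] and a nonempty set [S], the inclusion of [S] into [V] splits
    into a linear part and a base-point part ([subset_affineP]): translating one
    common point of [V] and [S] by the differences of elements of [S] yields all
    of [S], and [V] is stable under translation by the elements of [dir V]. *)

Local Open Scope classical_set_scope.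
Local Open Scope ring_scope.

Lemma normr_trmx (R : realType) m n (M : 'M[R]_(m, n)) : `|M^T| = `|M|.
Proof.
rewrite /Num.norm /= !mx_normrE.
rewrite (reindex (fun ij : 'I_m * 'I_n => (ij.2, ij.1))) /=.
  by apply: eq_bigr => -[i j] _; rewrite mxE.
by exists (fun ij : 'I_n * 'I_m => (ij.2, ij.1)) => -[].
Qed.

Lemma trmx_continuous (R : realType) m n :
  continuous (@trmx R m n).
Proof.
move=> M s /= /nbhs_ballP[e e0 es]; apply/nbhs_ballP; exists e => //= N [_ MN].
by apply: es; split=> // i j; rewrite !mxE; exact: MN.
Qed.

(** Heine-Borel is transported from row vectors by transposition, which is a
    norm-preserving homeomorphism. *)
Lemma cV_bounded_closed_compact (R : realType) n (X : set 'cV[R]_n) :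
  bounded_set X -> closed X -> compact X.
Proof.
move=> [M [Mreal XM]] Xcl.
have -> : X = trmx @` (trmx @^-1` X).
  apply/seteqP; split=> [x Xx|_ [y Xy <-]//].
  by exists x^T; rewrite /= trmxK.
apply: continuous_compact.
  by apply: continuous_subspaceT; exact: trmx_continuous.
apply: bounded_closed_compact.
  by exists M; split=> // r Mr x /= /(XM r Mr) /=; rewrite normr_trmx.
by apply: closed_comp => // x _; exact: trmx_continuous.
Qed.

Lemma mulmx_coord_continuous (R : realType) m n p (A : 'M[R]_(m, n)) i j :
  continuous (fun x : 'M[R]_(n, p) => (A *m x) i j).
Proof.
have -> : (fun x : 'M[R]_(n, p) => (A *m x) i j) =
          (fun x => \sum_k A i k * x k j).
  by apply/funext => x; rewrite mxE.
apply: continuous_big => [|k _ x]; first exact: add_continuous.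
by apply: continuousM; [exact: cst_continuous|exact: coord_continuous].
Qed.

Lemma closed_polyhedron (R : realType) m d (A : 'M[R]_(m, d)) (b : 'cV[R]_m) :
  closed (polyhedron A b).
Proof.
have -> : polyhedron A b =
    \bigcap_i ((fun x => (A *m x) i 0) @^-1` [set r | r <= b i 0]).
  by apply/seteqP; split=> [x Ax i _|x Ax i]; exact: Ax.
apply: closed_bigI => i _; apply: closed_comp; last exact: closed_le.
by move=> x _; exact: mulmx_coord_continuous.
Qed.

Lemma optimal_set_nonempty (R : realType) m d (A : 'M[R]_(m, d))
    (b : 'cV[R]_m) (c : 'cV[R]_d) :
  polyhedron A b !=set0 -> bounded_set (polyhedron A b) ->
  optimal_set (polyhedron A b) c !=set0.
Proof.
move=> X0 Xbnd.
have Xcpt : compact (polyhedron A b).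
  by apply: cV_bounded_closed_compact => //; exact: closed_polyhedron.
have [|x /set_mem Xx xmin] := @compact_EVT_min _ R (linobj c) _ X0 Xcpt.
  by apply: continuous_subspaceT; exact: mulmx_coord_continuous.
by exists x; split=> // y /mem_set; exact: xmin.
Qed.

Lemma argmin_setI_eq (R : realType) (T : Type) (X V : set T) (f : T -> R) :
  argmin X f !=set0 ->
  argmin (X `&` V) f = argmin X f <-> argmin X f `<=` V.
Proof.
move=> [z [Xz zmin]]; split=> [<- x [[]]//|subV].
have Vz : V z by apply: subV.
apply/seteqP; split=> [x [[Xx Vx] xmin]|x [Xx xmin]]; split=> //.
- (* [x] does at least as well as [z], a minimizer over all of [X]. *)
  by move=> y Xy; apply: le_trans (zmin _ Xy); exact: xmin.
- by split=> //; exact: subV.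
- by move=> y [Xy _]; exact: xmin.
Qed.

Lemma dir_subr (R : realType) d (S : set 'cV[R]_d) x y :
  S x -> S y -> dir S (x - y).
Proof.
move=> Sx Sy; exists [:: x - y]; last by rewrite memv_span ?mem_head.
by move=> u; rewrite inE => /eqP ->; exists x => //; exists y.
Qed.

Lemma dir_subset (R : realType) d (S T : set 'cV[R]_d) :
  S `<=` T -> dir S `<=` dir T.
Proof.
move=> ST v [s sS vs]; exists s => // u /sS[x Sx [y Sy <-]].
by exists x; [exact: ST|exists y => //; exact: ST].
Qed.

Lemma affine_subspace_addr (R : realType) d (V : set 'cV[R]_d) x u :
  affine_subspace V -> V x -> dir V u -> V (x + u).
Proof.
move=> [p [L ->]] [v vL <-] [s sV us].
have /subvP/(_ _ us) uL : (span s <= L)%VS.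
  apply/span_subvP => _ /sV[_ [w1 w1L <-] [_ [w2 w2L <-] <-]].
  by rewrite opprD addrACA subrr add0r rpredB.
by exists (v + u); [exact: rpredD|rewrite addrA].
Qed.

Lemma subset_affineP (R : realType) d (V S : set 'cV[R]_d) :
  affine_subspace V -> S !=set0 ->
  S `<=` V <-> dir S `<=` dir V /\ V `&` S !=set0.
Proof.
move=> Vaff [x Sx]; split=> [SV|[dSV [z [Vz Sz]]] y Sy].
  by split; [exact: dir_subset|exists x; split=> //; exact: SV].
rewrite -(subrKC z y); apply: affine_subspace_addr => //.
by apply: dSV; exact: dir_subr.
Qed.

Theorem theorem2 (R : realType) (m d : nat) (A : 'M[R]_(m, d)) (b : 'cV[R]_m)
    (C V : set 'cV[R]_d)
    (X_neq0 : polyhedron A b !=set0) (X_bounded : bounded_set (polyhedron A b))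
    (C_neq0 : C !=set0) (C_convex : convex_set C)
    (V_affine : affine_subspace V) :
  exact_sketching (polyhedron A b) C V <->
  dir (reachable_optima (polyhedron A b) C) `<=` dir V /\
  V `&` reachable_optima (polyhedron A b) C !=set0.
Proof.
have opt0 c : optimal_set (polyhedron A b) c !=set0.
  exact: optimal_set_nonempty.
have reach0 : reachable_optima (polyhedron A b) C !=set0.
  by case: C_neq0 => c Cc; have [x xc] := opt0 c; exists x, c.
apply: iff_trans (subset_affineP _ _ V _ V_affine reach0); split=> [ex|sub c Cc].
  by apply: bigcup_sub => c Cc; apply/argmin_setI_eq; [exact: opt0|exact: ex].
by apply/argmin_setI_eq; [exact: opt0|move=> x xc; apply: sub; exists c].
Qed.
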